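(* Let $\alpha\in(0,1)$, $\theta=\alpha/2$, and let $0=t_0<t_1<\cdots<t_N=T$ be a time mesh with steps $\tau_k=t_k-t_{k-1}$ and step ratios $r_k=\tau_k/\tau_{k-1}$ satisfying $r_k\ge r_\star(\alpha)$ for all $k\ge2$, where $r_\star(\alpha)$ is the unique positive root $r$ of $$2\sqrt{\frac{2(1-\alpha/2)r}{1+\alpha+(1-\alpha/2)r}+\frac{r}{1+r}}+3-\frac{1}{r^2(1+r)}=0.$$ Then for every real sequence $v^0,\dots,v^N$ and every $1\le n\le N$, $$2(\nabla_\tau v^n)(\partial^\alpha_\tau v)^{n-\theta}=\mathcal G_n[\nabla_\tau v]-\mathcal G_{n-1}[\nabla_\tau v]+\mathcal R_n[\nabla_\tau v]+\frac{2\alpha a^{(n)}_0}{2-\alpha}(\nabla_\tau v^n)^2,$$ where the functionals $\mathcal G_n,\mathcal R_n$ (defined in the context) are nonnegative.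
   Context: Notation: $\nabla_\tau v^k:=v^k-v^{k-1}$; $\omega_\beta(t):=t^{\beta-1}/\Gamma(\beta)$; $t_{n-\theta}:=\theta t_{n-1}+(1-\theta)t_n$; $\varpi_n'(t):=\omega_{1-\alpha}(t_{n-\theta}-t)$. For $1\le k\le n$: $$a^{(n)}_{n-k}:=\frac{1}{\tau_k}\int_{t_{k-1}}^{\min\{t_k,t_{n-\theta}\}}\varpi_n'(s)\,ds,\qquad \zeta^{(n)}_{n-k}:=\frac{2}{\tau_k^2}\int_{t_{k-1}}^{t_k}\Big(s-\tfrac{t_{k-1}+t_k}{2}\Big)\varpi_n'(s)\,ds.$$ The variable-step L2-$1_\sigma$ approximation of the Caputo derivative is $$(\partial^\alpha_\tau v)^{n-\theta}:=a^{(n)}_0\nabla_\tau v^n+\sum_{k=1}^{n-1}\Big(a^{(n)}_{n-k}\nabla_\tau v^k+\frac{\nabla_\tau v^{k+1}-r_{k+1}\nabla_\tau v^k}{r_{k+1}(1+r_{k+1})}\zeta^{(n)}_{n-k}\Big).$$ Kernels: $\hat a^{(1)}_0:=\frac{2(1-\alpha)}{2-\alpha}a^{(1)}_0$; for $n\ge2$: $\hat a^{(n)}_0:=\frac{2(1-\alpha)}{2-\alpha}a^{(n)}_0+\frac{\zeta^{(n)}_1}{r_n(1+r_n)}$, $\hat a^{(n)}_{n-k}:=a^{(n)}_{n-k}+\frac{\zeta^{(n)}_{n-k+1}}{r_k(1+r_k)}-\frac{\zeta^{(n)}_{n-k}}{1+r_{k+1}}$ for $2\le k\le n-1$, $\hat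 a^{(n)}_{n-1}:=a^{(n)}_{n-1}-\frac{\zeta^{(n)}_{n-1}}{1+r_2}$. Set $A^{(n)}_0:=2\hat a^{(n)}_0$ and $A^{(n)}_{n-k}:=\hat a^{(n)}_{n-k}$ for $1\le k\le n-1$. For a sequence $w=(w^1,w^2,\dots)$ and $m\ge1$: $$\mathcal G_m[w]:=\sum_{j=1}^{m-1}\big(A^{(m)}_{m-j-1}-A^{(m)}_{m-j}\big)\Big(\sum_{\ell=j+1}^m w^\ell\Big)^2+A^{(m)}_{m-1}\Big(\sum_{\ell=1}^m w^\ell\Big)^2,\qquad \mathcal G_0[w]:=0,$$ $$\mathcal R_m[w]:=\sum_{j=1}^{m-1}\big(A^{(m-1)}_{m-j-2}-A^{(m-1)}_{m-j-1}-A^{(m)}_{m-j-1}+A^{(m)}_{m-j}\big)\Big(\sum_{\ell=j+1}^{m-1}w^\ell\Big)^2+\big(A^{(m-1)}_{m-2}-A^{(m)}_{m-1}\big)\Big(\sum_{\ell=1}^{m-1}w^\ell\Big)^2$$ for $m\ge2$, and $\mathcal R_1[w]:=0$ (empty sums vanish). Here $\nabla_\tau v$ denotes the sequence $(\nabla_\tau v^1,\nabla_\tau v^2,\dots)$. *)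

(* Defs.v *)
From HB Require Import structures.
From mathcomp Require Import all_boot all_order all_algebra.
From mathcomp Require Import all_classical all_reals all_analysis.
Set Implicit Arguments. Unset Strict Implicit. Unset Printing Implicit Defensive.
Import Order.TTheory GRing.Theory Num.Theory.
Import numFieldNormedType.Exports.
Local Open Scope classical_set_scope.
Local Open Scope ring_scope.

Section L21sigma.
Variable R : realType.
Notation leb := (@lebesgue_measure R).

Definition Gamma (b : R) : R :=
  \int[leb]_(x in `]0%R, +oo[) (x `^ (b - 1) * expR (- x)).

Definition omega (b t : R) : R := t `^ (b - 1) / Gamma b.

Definition tau (t : nat -> R) (k : nat) : R := t k - t k.-1.
Definition step_ratio (t : nat -> R) (k : nat) : R := tau t k / tau t k.-1.
Definition theta (al : R) : R := al / 2.
Definition tnth (al : R) (t : nat -> R) (n : nat) : R :=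
  theta al * t n.-1 + (1 - theta al) * t n.

Definition akern (al : R) (t : nat -> R) (n j : nat) : R :=
  let k := (n - j)%N in
  (tau t k)^-1 * \int[leb]_(s in `[t k.-1, Num.min (t k) (tnth al t n)])
                   omega (1 - al) (tnth al t n - s).

Definition zeta (al : R) (t : nat -> R) (n j : nat) : R :=
  let k := (n - j)%N in
  2 / (tau t k ^+ 2) * \int[leb]_(s in `[t k.-1, t k])
     ((s - (t k.-1 + t k) / 2) * omega (1 - al) (tnth al t n - s)).

Definition nabla (v : nat -> R) (k : nat) : R := v k - v k.-1.

Definition caputoL21 (al : R) (t v : nat -> R) (n : nat) : R :=
  akern al t n 0 * nabla v n +
  \sum_(1 <= k < n)
     (akern al t n (n - k) * nabla v k +
      (nabla v k.+1 - step_ratio t k.+1 * nabla v k)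
        / (step_ratio t k.+1 * (1 + step_ratio t k.+1)) * zeta al t n (n - k)).

(* hat a^{(n)}_j, with k = n - j (only meaningful for j <= n - 1) *)
Definition ahat (al : R) (t : nat -> R) (n j : nat) : R :=
  let c := 2 * (1 - al) / (2 - al) in
  if n == 1%N then c * akern al t 1 0
  else if j == 0%N then
    c * akern al t n 0 + zeta al t n 1 / (step_ratio t n * (1 + step_ratio t n))
  else if j == n.-1 then
    akern al t n n.-1 - zeta al t n n.-1 / (1 + step_ratio t 2)
  else
    let k := (n - j)%N in
    akern al t n j + zeta al t n j.+1 / (step_ratio t k * (1 + step_ratio t k))
      - zeta al t n j / (1 + step_ratio t k.+1).

Definition Akern (al : R) (t : nat -> R) (n j : nat) : R :=
  if j == 0%N then 2 * ahat al t n 0 else ahat al t n j.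

Definition Gfun (al : R) (t : nat -> R) (w : nat -> R) (m : nat) : R :=
  if m == 0%N then 0 else
  \sum_(1 <= j < m)
     (Akern al t m (m - j - 1) - Akern al t m (m - j))
       * (\sum_(j.+1 <= l < m.+1) w l) ^+ 2
  + Akern al t m (m - 1) * (\sum_(1 <= l < m.+1) w l) ^+ 2.

(* R_m[w]; R_0 = R_1 = 0.  For j = m-1 the index m-j-2 is negative, but the
   corresponding squared sum is empty (= 0), so the value used is irrelevant. *)
Definition Rfun (al : R) (t : nat -> R) (w : nat -> R) (m : nat) : R :=
  if (m < 2)%N then 0 else
  \sum_(1 <= j < m)
     (Akern al t m.-1 (m - j - 2) - Akern al t m.-1 (m - j - 1)
        - Akern al t m (m - j - 1) + Akern al t m (m - j))
       * (\sum_(j.+1 <= l < m) w l) ^+ 2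
  + (Akern al t m.-1 (m - 2) - Akern al t m (m - 1))
       * (\sum_(1 <= l < m) w l) ^+ 2.

Definition rstar_eq (al r : R) : R :=
  2 * Num.sqrt (2 * (1 - al / 2) * r / (1 + al + (1 - al / 2) * r)
                + r / (1 + r))
  + 3 - 1 / (r ^+ 2 * (1 + r)).

End L21sigma.

(* Main.v *)
Require Import Defs.
From HB Require Import structures.
From mathcomp Require Import all_boot all_order all_algebra.
From mathcomp Require Import all_classical all_reals all_analysis.
From mathcomp Require Import measurable_realfun ring lra zify.
Import Order.TTheory GRing.Theory Num.Theory.
Import numFieldNormedType.Exports.
Local Open Scope ring_scope.

(** Since theta = al / 2, the factor 2 (1 - al) / (2 - al) turns a^(n)_0 into
the kernel value G_n(t_{n-1}), G_n(s) = omega_{1-al}(t_{n-theta} - s), and the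
identity is then an Abel summation.  Nonnegativity amounts to second-difference
inequalities for A^(n).  Both G_n and G_n - G_{n+1} are nonnegative, increasing
and convex below t_{n-theta}; comparing such a kernel on three consecutive
cells with the line whose slope p is its derivative at t_{k-1} bounds each cell
average and each first moment by exact moments of affine functions.  With
tau = tau_k and r' = r_{k+1} the second difference is then at least
  tau p / 6 * (3 + 1 / r' + kappa r' - 1 / (r_k^2 (1 + r_k))),
and 1 / r' + kappa r' >= 2 sqrt kappa gives the equation defining r_star.  On
the last cell the average minus the weighted first moment of G_{n+1} has a
closed form, which provides the kappa r' term there. *)

(** * Moments over one cell and comparison with affine functions *)

Section Integrals.
Set Implicit Arguments. Unset Strict Implicit.
Variable R : realType.
Local Open Scope classical_set_scope.
Notation leb := (@lebesgue_measure R).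
Implicit Types (f F G : R -> R) (a b p : R).

Lemma pointwise_within_continuous f (l h : R) :
  (forall x, l <= x <= h -> {for x, continuous f}) ->
  {within `[l, h]%classic, continuous f}.
Proof.
move=> cf; apply: continuous_in_subspaceT => x /[!inE] /=.
by rewrite in_itv /=; exact: cf.
Qed.

Lemma continuous_itv_integrable f (l h : R) :
  (forall x, l <= x <= h -> {for x, continuous f}) ->
  leb.-integrable `[l, h]%classic (EFin \o f).
Proof.
move=> cf; apply: continuous_compact_integrable; first exact: segment_compact.
exact: pointwise_within_continuous.
Qed.

Lemma Rintegral_FTC F f (l h : R) : l < h ->
  (forall x, l <= x <= h -> is_derive x 1 F (f x)) ->
  (forall x, l <= x <= h -> {for x, continuous f}) ->
  \int[leb]_(x in `[l, h]) f x = F h - F l.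
Proof.
move=> lh dF cf.
have cF : {within `[l, h]%classic, continuous F}.
  apply: derivable_within_continuous => x; rewrite in_itv /= => /dF [].
  by [].
rewrite /Rintegral (@continuous_FTC2 _ f F) // -?EFinB //.
- exact: pointwise_within_continuous.
- case/(continuous_within_itvP _ lh): cF => cF cl ch; split => // x.
  rewrite in_itv /= => /andP[lx xh].
  by have [] := dF x (introT andP (conj (ltW lx) (ltW xh))).
- move=> x; rewrite in_itv /= => /andP[lx xh].
  have := dF x (introT andP (conj (ltW lx) (ltW xh))).
  by move=> dx; rewrite derive1E derive_val.
Qed.

(** Centring the weight at the midpoint decouples the constant and linear parts of an affine [G]: no
    cross terms remain in [moment_affine]. *)
Definition moment G a b l h : R :=
  \int[leb]_(s in `[l, h]) ((a + b * (s - (l + h) / 2)) * G s).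

Lemma continuous_affine (a b m x : R) :
  {for x, continuous (fun s : R => a + b * (s - m))}.
Proof.
apply: cvgD; first exact: cvg_cst.
apply: cvgM; first exact: cvg_cst.
by apply: cvgB; [exact: cvg_id|exact: cvg_cst].
Qed.

Lemma continuous_affine_mul G a b m (x : R) : {for x, continuous G} ->
  {for x, continuous (fun s : R => (a + b * (s - m)) * G s)}.
Proof.
by move=> cG; apply: cvgM => //; exact: continuous_affine.
Qed.

Lemma moment_affine a b (g0 : R) p (l h : R) : l < h ->
  moment (fun s => g0 + p * (s - (l + h) / 2)) a b l h =
  a * g0 * (h - l) + b * p * (h - l) ^+ 3 / 12.
Proof.
move=> lh; set m := (l + h) / 2.
pose F := fun s : R => a * g0 * (s - m) + (a * p + b * g0) / 2 * (s - m) ^+ 2 +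
   b * p / 3 * (s - m) ^+ 3.
have dF (x : R) : l <= x <= h ->
    is_derive x 1 F ((a + b * (x - m)) * (g0 + p * (x - m))).
  by move=> _; apply: is_derive_eq; rewrite /GRing.scale /=; field.
rewrite /moment -/m (Rintegral_FTC lh dF); first by rewrite /F /m; field.
by move=> x _; apply: continuous_affine_mul; exact: continuous_affine.
Qed.

Lemma le_moment F G a b a' b' (l h : R) :
  (forall x, l <= x <= h -> {for x, continuous F}) ->
  (forall x, l <= x <= h -> {for x, continuous G}) ->
  (forall x, l <= x <= h -> (a + b * (x - (l + h) / 2)) * F x <=
                            (a' + b' * (x - (l + h) / 2)) * G x) ->
  moment F a b l h <= moment G a' b' l h.
Proof.
move=> cF cG FG; apply: le_Rintegral => //.
- by apply: continuous_itv_integrable => x /cF; exact: continuous_affine_mul.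
- by apply: continuous_itv_integrable => x /cG; exact: continuous_affine_mul.
Qed.

Lemma momentB F G a b (l h : R) :
  (forall x, l <= x <= h -> {for x, continuous F}) ->
  (forall x, l <= x <= h -> {for x, continuous G}) ->
  moment (fun s => F s - G s) a b l h = moment F a b l h - moment G a b l h.
Proof.
move=> cF cG; rewrite /moment -RintegralB //.
- by apply: eq_Rintegral => x _; rewrite mulrBr.
- by apply: continuous_itv_integrable => x /cF; exact: continuous_affine_mul.
- by apply: continuous_itv_integrable => x /cG; exact: continuous_affine_mul.
Qed.

Lemma moment_weightB G a b a' b' k (l h : R) :
  (forall x, l <= x <= h -> {for x, continuous G}) ->
  moment G (a - k * a') (b - k * b') l h
  = moment G a b l h - k * moment G a' b' l h.
Proof.
move=> cG.
have ic a0 b0 : leb.-integrable `[l, h]%classic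
    (EFin \o (fun s => (a0 + b0 * (s - (l + h) / 2)) * G s)).
  by apply: continuous_itv_integrable => x /cG; exact: continuous_affine_mul.
rewrite /moment -RintegralZl // -RintegralB //.
- by apply: eq_Rintegral => x _; ring.
- have -> : (fun x => k * ((a' + b' * (x - (l + h) / 2)) * G x)) =
    (fun x => (k * a' + (k * b') * (x - (l + h) / 2)) * G x).
    by apply/funext => x; ring.
  exact: ic.
Qed.

(** For G_n on the cell [t_{k-1}, t_k] with 1 <= k < n, [mean] is a^(n)_{n-k} and [slant] is
    zeta^(n)_{n-k}. The normalising factors sit in the weight, so that combinations of the two are
    again moments. *)
Definition mean G (l h : R) := moment G (h - l)^-1 0 l h.
Definition slant G (l h : R) := moment G 0 (2 / (h - l) ^+ 2) l h.

Lemma meanB_slant G k (l h : R) :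
  (forall x, l <= x <= h -> {for x, continuous G}) ->
  mean G l h - k * slant G l h =
  moment G (h - l)^-1 (- (k * (2 / (h - l) ^+ 2))) l h.
Proof.
by move=> cG; rewrite -moment_weightB // mulr0 subr0 sub0r.
Qed.

(** Comparison with the line of slope p through (m, G m), m the midpoint: (s - m) (G s - G m) <= p
    (s - m)^2 on both sides of m, and the slant of the line is exact. *)
Lemma slant_le G p (l h : R) : l < h ->
  (forall x, l <= x <= h -> {for x, continuous G}) ->
  (forall x y, l <= x -> x <= y -> y <= h -> G y - G x <= p * (y - x)) ->
  slant G l h <= (h - l) * p / 6.
Proof.
move=> lh cG sG; set m := (l + h) / 2.
have h0 : 0 < h - l by rewrite subr_gt0.
have -> : (h - l) * p / 6 =
    moment (fun s => G m + p * (s - m)) 0 (2 / (h - l) ^+ 2) l h.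
  by rewrite moment_affine // ; field; rewrite gt_eqF.
apply: le_moment => // [x _|x /andP[lx xh]]; first exact: continuous_affine.
rewrite -/m !add0r -!mulrA ler_wpM2l //.
rewrite ler_wpM2l ?invr_ge0 ?sqr_ge0 //.
have lm : l <= m by rewrite /m; lra.
have mh : m <= h by rewrite /m; lra.
have [xm|/ltW mx] := lerP x m.
  by rewrite ler_wnM2l ?subr_le0 //; have := sG x m lx xm mh; lra.
by rewrite ler_wpM2l ?subr_ge0 //; have := sG m x lm mx xh; lra.
Qed.

Lemma slant_ge G p (l h : R) : l < h ->
  (forall x, l <= x <= h -> {for x, continuous G}) ->
  (forall x y, l <= x -> x <= y -> y <= h -> p * (y - x) <= G y - G x) ->
  (h - l) * p / 6 <= slant G l h.
Proof.
move=> lh cG sG; set m := (l + h) / 2.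
have h0 : 0 < h - l by rewrite subr_gt0.
have -> : (h - l) * p / 6 =
    moment (fun s => G m + p * (s - m)) 0 (2 / (h - l) ^+ 2) l h.
  by rewrite moment_affine // ; field; rewrite gt_eqF.
apply: le_moment => // [x _|x /andP[lx xh]]; first exact: continuous_affine.
rewrite -/m !add0r -!mulrA ler_wpM2l //.
rewrite ler_wpM2l ?invr_ge0 ?sqr_ge0 //.
have lm : l <= m by rewrite /m; lra.
have mh : m <= h by rewrite /m; lra.
have [xm|/ltW mx] := lerP x m.
  by rewrite ler_wnM2l ?subr_le0 //; have := sG x m lx xm mh; lra.
by rewrite ler_wpM2l ?subr_ge0 //; have := sG m x lm mx xh; lra.
Qed.

(** [G] lies below the line of slope p through (h, G h), whose average is the bound. *)
Lemma mean_le G p (l h : R) : l < h ->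
  (forall x, l <= x <= h -> {for x, continuous G}) ->
  (forall x y, l <= x -> x <= y -> y <= h -> p * (y - x) <= G y - G x) ->
  mean G l h <= G h - (h - l) * p / 2.
Proof.
move=> lh cG sG; set m := (l + h) / 2.
have h0 : 0 < h - l by rewrite subr_gt0.
have -> : G h - (h - l) * p / 2 =
    moment (fun s => G h - (h - l) * p / 2 + p * (s - m)) (h - l)^-1 0 l h.
  by rewrite moment_affine // ; field; rewrite gt_eqF.
apply: le_moment => // [x _|x /andP[lx xh]]; first exact: continuous_affine.
rewrite !mul0r !addr0 ler_wpM2l ?invr_ge0 ?(ltW h0) //.
have -> : G h - (h - l) * p / 2 + p * (x - m) = G h - p * (h - x).
  by rewrite /m; field.
by have := sG x h lx xh (lexx _); lra.
Qed.

(** Up to the factor (h - l)^-2 the weight is (h - l) - k (2 x - l - h), and 2 x - l - h <= h - l on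
    the cell. *)
Lemma meanB_slant_weight_ge0 k (l h x : R) : l < h -> 0 <= k <= 1 ->
  l <= x <= h ->
  0 <= (h - l)^-1 + - (k * (2 / (h - l) ^+ 2)) * (x - (l + h) / 2).
Proof.
move=> lh /andP[k0 k1] /andP[lx xh].
have h0 : 0 < h - l by rewrite subr_gt0.
have -> : (h - l)^-1 + - (k * (2 / (h - l) ^+ 2)) * (x - (l + h) / 2) =
   (h - l) ^- 2 * ((h - l) - k * (x - l + x - h)).
  by field; rewrite gt_eqF.
rewrite mulr_ge0 ?invr_ge0 ?sqr_ge0 // subr_ge0.
have [w0|/ltW w0] := lerP (x - l + x - h) 0.
  by apply: (@le_trans _ _ 0); [exact: mulr_ge0_le0|exact: ltW].
by apply: (@le_trans _ _ (1 * (x - l + x - h))); [exact: ler_wpM2r|lra].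
Qed.

Lemma meanB_slant_ge0 G k (l h : R) : l < h -> 0 <= k <= 1 ->
  (forall x, l <= x <= h -> {for x, continuous G}) ->
  (forall x, l <= x <= h -> 0 <= G x) ->
  0 <= mean G l h - k * slant G l h.
Proof.
move=> lh k01 cG G0; rewrite meanB_slant //.
apply: Rintegral_ge0 => x /=; rewrite in_itv /= => xlh.
by rewrite mulr_ge0 ?G0 // meanB_slant_weight_ge0.
Qed.

(** [G] lies above the line of slope p through (l, G l). The weight is nonnegative for k in [0, 1],
    so this passes to the moments, and the moment of the line is the left side. *)
Lemma meanB_slant_ge G k p (l h : R) : l < h -> 0 <= k <= 1 ->
  (forall x, l <= x <= h -> {for x, continuous G}) ->
  (forall x y, l <= x -> x <= y -> y <= h -> p * (y - x) <= G y - G x) ->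
  G l + (h - l) * p * (1 / 2 - k / 6) <= mean G l h - k * slant G l h.
Proof.
move=> lh k01 cG sG; rewrite meanB_slant //; set m := (l + h) / 2.
have h0 : 0 < h - l by rewrite subr_gt0.
have -> : G l + (h - l) * p * (1 / 2 - k / 6) =
    moment (fun s => G l + (h - l) * p / 2 + p * (s - m)) (h - l)^-1
      (- (k * (2 / (h - l) ^+ 2))) l h.
  by rewrite moment_affine // ; field; rewrite gt_eqF.
apply: le_moment => // [x _|x /[dup] xlh /andP[lx xh]].
  exact: continuous_affine.
rewrite ler_wpM2l //; first exact: meanB_slant_weight_ge0.
have -> : G l + (h - l) * p / 2 + p * (x - m) = G l + p * (x - l).
  by rewrite /m; field.
by have := sG l x (lexx _) lx xh; lra.
Qed.

End Integrals.

(** * Convex kernels built from negative powers, and their singular integral *)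

Section PowerKernels.
Set Implicit Arguments. Unset Strict Implicit.
Variable R : realType.
Local Open Scope classical_set_scope.
Notation leb := (@lebesgue_measure R).
Implicit Types (T x y a b : R).

Lemma is_derive_powRBl T b x : x < T ->
  is_derive x 1 (fun s : R => (T - s) `^ b) (- (b * (T - x) `^ (b - 1))).
Proof.
move=> xT; have dB : is_derive x 1 (fun s : R => T - s) (-1).
  by apply: is_derive_eq; rewrite add0r mul1r.
have dp : is_derive (T - x) 1 (fun s => powR s b) (b * (T - x) `^ (b - 1)).
  by apply: is_derive1_powR; rewrite subr_gt0.
have := @is_derive1_comp R (fun y => y `^ b) (fun s : R => T - s) x _ _ dp dB.
by rewrite /GRing.scale /= mulrN1.
Qed.

Lemma is_derive_continuous (f : R -> R) (x df : R) :
  is_derive x 1 f df -> {for x, continuous f}.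
Proof.
by move=> [d _]; apply: differentiable_continuous; exact/derivable1_diffP.
Qed.

Lemma powRN_ge x y b : 0 <= b -> 0 < x -> x <= y -> y `^ (- b) <= x `^ (- b).
Proof.
move=> b0 x0 xy; have y0 := lt_le_trans x0 xy.
rewrite !powRN lef_pV2 ?posrE ?powR_gt0 // ge0_ler_powR // nnegrE ltW //.
Qed.

Lemma le_increment (f df : R -> R) (p x y : R) :  x <= y ->
  (forall z, x <= z <= y -> is_derive z 1 f (df z)) ->
  (forall z, x <= z <= y -> p <= df z) -> p * (y - x) <= f y - f x.
Proof.
move=> xy dF pd.
have [z zxy| |c] := @MVT_segment R f df x y xy.
- apply: dF; move: zxy; rewrite in_itv /= => /andP[xz zy].
  by rewrite !ltW.
- by apply: pointwise_within_continuous => z /dF; exact: is_derive_continuous.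
- rewrite in_itv /= => cxy ->; rewrite ler_wpM2r ?subr_ge0 //.
  exact: pd.
Qed.

Lemma ge_increment (f df : R -> R) (p x y : R) :  x <= y ->
  (forall z, x <= z <= y -> is_derive z 1 f (df z)) ->
  (forall z, x <= z <= y -> df z <= p) -> f y - f x <= p * (y - x).
Proof.
move=> xy dF pd.
have [z zxy| |c] := @MVT_segment R f df x y xy.
- apply: dF; move: zxy; rewrite in_itv /= => /andP[xz zy].
  by rewrite !ltW.
- by apply: pointwise_within_continuous => z /dF; exact: is_derive_continuous.
- rewrite in_itv /= => cxy ->; rewrite ler_wpM2r ?subr_ge0 //.
  exact: pd.
Qed.

(** The derivative is carried explicitly because its value at a mesh point serves as the slope of
    the comparison line. *)
Definition convex_kernel (G dG : R -> R) (T : R) : Prop :=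
  [/\ forall x, x < T -> is_derive x 1 G (dG x),
      forall x y, x <= y -> y < T -> dG x <= dG y,
      forall x, x < T -> 0 <= dG x &
      forall x, x < T -> 0 <= G x].

Lemma convex_kernel_continuous G dG T x :
  convex_kernel G dG T -> x < T -> {for x, continuous G}.
Proof. by case=> dGP _ _ _ /dGP; exact: is_derive_continuous. Qed.

Lemma convex_kernel_le_slope G dG T c x y : convex_kernel G dG T ->
  x <= y -> y <= c -> c < T -> G y - G x <= dG c * (y - x).
Proof.
move=> [dGP dGm _ _] xy yc cT; apply: (ge_increment xy) => z /andP[xz zy].
- by apply: dGP; rewrite (le_lt_trans _ cT) // (le_trans zy).
- by apply: dGm => //; exact: le_trans yc.
Qed.

Lemma convex_kernel_ge_slope G dG T c x y : convex_kernel G dG T ->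
  c <= x -> x <= y -> y < T -> dG c * (y - x) <= G y - G x.
Proof.
move=> [dGP dGm _ _] cx xy yT; apply: (le_increment xy) => z /andP[xz zy].
- by apply: dGP; rewrite (le_lt_trans zy).
- by apply: dGm; [exact: le_trans xz|rewrite (le_lt_trans zy)].
Qed.

(* Both G_n (sg = 0) and G_n - G_{n+1} (sg = 1) have this form. *)
Definition power_kernel_diff (g T T' sg b s : R) : R :=
  g * ((T - s) `^ (- b) - sg * (T' - s) `^ (- b)).

Lemma power_kernel_diff_ge0 (g T T' sg b s : R) :
  0 <= g -> T <= T' -> 0 <= sg <= 1 ->
  0 <= b -> s < T -> 0 <= power_kernel_diff g T T' sg b s.
Proof.
move=> g0 TT' /andP[s0 s1] b0 sT; rewrite mulr_ge0 // subr_ge0.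
have h : (T' - s) `^ (- b) <= (T - s) `^ (- b).
  by apply: powRN_ge; rewrite ?subr_gt0 ?lerB.
by rewrite (le_trans _ h) // ler_piMl ?powR_ge0.
Qed.

Lemma is_derive_power_kernel_diff (g T T' sg b s : R) : T <= T' -> s < T ->
  is_derive s 1 (power_kernel_diff g T T' sg b)
    (power_kernel_diff (b * g) T T' sg (b + 1) s).
Proof.
move=> TT' sT; have sT' := lt_le_trans sT TT'.
have d1 := is_derive_powRBl (- b) sT; have d2 := is_derive_powRBl (- b) sT'.
apply: is_derive_eq.
by rewrite /power_kernel_diff /GRing.scale /= -!opprD; ring.
Qed.

(** Differentiation stays in the family, with g replaced by b g and b by b + 1. Hence positivity of
    the kernel, of its slope and of its second derivative are three instances of
    [power_kernel_diff_ge0]. *)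
Lemma convex_power_kernel_diff (g T T' sg b : R) :
  0 <= g -> T <= T' -> 0 <= sg <= 1 ->
  0 <= b -> convex_kernel (power_kernel_diff g T T' sg b)
    (power_kernel_diff (b * g) T T' sg (b + 1)) T.
Proof.
move=> g0 TT' sg01 b0.
have b10 : 0 <= b + 1 by rewrite addr_ge0.
have b20 : 0 <= b + 1 + 1 by rewrite addr_ge0.
have bg0 : 0 <= b * g by exact: mulr_ge0.
split=> [x xT|x y xy yT|x xT|x xT]; try exact: power_kernel_diff_ge0.
- exact: is_derive_power_kernel_diff.
- rewrite -subr_ge0 -[leLHS](mul0r (y - x)).
  apply: (@le_increment _
    (power_kernel_diff ((b + 1) * (b * g)) T T' sg (b + 1 + 1))) => //.
    move=> z /andP[_ zy]; apply: is_derive_power_kernel_diff => //.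
    exact: le_lt_trans yT.
  move=> z /andP[_ zy]; apply: power_kernel_diff_ge0 => //; first exact: mulr_ge0.
  exact: le_lt_trans yT.
Qed.

Lemma powR_primitive (T al s : R) : al < 1 -> s < T ->
  is_derive s 1 (fun x => - ((T - x) `^ (1 - al) / (1 - al))) ((T - s) `^ (- al)).
Proof.
move=> al1 sT; have d := is_derive_powRBl (1 - al) sT.
have al0 : 1 - al != 0 by rewrite gt_eqF // subr_gt0.
apply: is_derive_eq; rewrite /GRing.scale /=.
have -> : 1 - al - 1 = - al by ring.
by field.
Qed.

(** The integrand blows up at T, so the fundamental theorem is applied on [a, T - 1/(k+1)], and
    monotone convergence gives the integral as the limit. *)
Lemma Rintegral_powRN_singular (a T al g : R) : 0 < al < 1 -> 0 <= g -> a < T ->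
  \int[leb]_(s in `[a, T]) (g * (T - s) `^ (- al)) =
  g * ((T - a) `^ (1 - al) / (1 - al)).
Proof.
move=> /andP[al0 al1] g0 aT.
pose f := fun s : R => g * (T - s) `^ (- al).
have al10 : 0 < 1 - al by rewrite subr_gt0.
have mf (D : set R) : measurable_fun D f.
  apply: measurable_funTS.
  apply: measurable_funM => //.
  apply: (measurableT_comp (measurable_powR _)).
  exact: measurable_funB.
have f0 s : 0 <= f s by rewrite mulr_ge0 ?powR_ge0.
have cvg1 := @ge0_nondecreasing_set_cvg_integral _ (measurableTypeR R) R
  (fun k => `[a, T - k.+1%:R^-1]) (EFin \o f) leb.
have {}cvg1 : (\int[leb]_(x in `[a, (T - k.+1%:R^-1)%R]) (f x)%:E)%E
    @[k --> \oo] --> (\int[leb]_(x in `[a, T]) (f x)%:E)%E.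
  (* Without the endpoint T, a null set, the interval is the union of the truncated ones. *)
  rewrite -integral_itv_bndo_bndc; last by apply/measurable_EFinP; exact: mf.
  rewrite itv_bnd_open_bigcup; apply: cvg1.
  - apply/nondecreasing_seqP => n; apply/subsetPset => x /=.
    rewrite !in_itv /= => /andP[-> /= /le_trans]; apply.
    by rewrite lerD2l lerN2 lef_pV2 ?posrE // ler_nat.
  - by move=> i; exact: measurable_itv.
  - by move=> i; apply/measurable_EFinP; exact: mf.
  - by move=> i x _; rewrite lee_fin f0.
(* These are the truncated values given by the primitive; the boundary term vanishes in the limit
   because 1 - al > 0. *)
have cvg2 : (g * ((T - a) `^ (1 - al) / (1 - al)) -
     g * ((k.+1%:R^-1) `^ (1 - al) / (1 - al)))%:E @[k --> \oo] -->
     (g * ((T - a) `^ (1 - al) / (1 - al)))%:E.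
  apply: cvg_EFin; first exact: nearW.
  rewrite -[X in _ --> X]subr0; apply: cvgB; first exact: cvg_cst.
  rewrite -(mulr0 g); apply: cvgM; first exact: cvg_cst.
  rewrite -(mul0r (1 - al)^-1); apply: cvgM; last exact: cvg_cst.
  have /cvg_at_rightP := @powR_cvg0 R _ al10; apply; split.
    by move=> n; rewrite invr_gt0.
  exact: cvg_harmonic.
rewrite /Rintegral; suff -> : (\int[leb]_(x in `[a, T]) (f x)%:E =
  (g * ((T - a) `^ (1 - al) / (1 - al)))%:E)%E by [].
apply: cvg_unique cvg1 _; first exact: ereal_hausdorff.
(* The two sequences need only agree eventually, once a < T - 1/(n+1). *)
apply: cvg_trans cvg2; apply: near_eq_cvg; near=> n.
have an : a < T - n.+1%:R^-1.
  rewrite ltrBrDr -ltrBrDl; near: n.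
  have := @cvg_harmonic R; move/cvgrPdist_lt => /(_ (T - a)).
  rewrite subr_gt0 => /(_ aT) [N _ hN]; exists N => // n /hN /=.
  by rewrite sub0r normrN ger0_norm ?invr_ge0.
have n0 : 0 < n.+1%:R^-1 :> R by rewrite invr_gt0.
have dP (s : R) : a <= s <= T - n.+1%:R^-1 ->
    is_derive s 1 (fun x => g * - ((T - x) `^ (1 - al) / (1 - al))) (f s).
  move=> /andP[_ sn]; have sT : s < T by rewrite (le_lt_trans sn) // ltrBlDr ltrDl.
  have d := powR_primitive al1 sT.
  by apply: is_derive_eq; rewrite /GRing.scale /= /f; ring.
have cf (s : R) : a <= s <= T - n.+1%:R^-1 -> {for s, continuous f}.
  move=> /andP[_ sn]; have sT : s < T by rewrite (le_lt_trans sn) // ltrBlDr ltrDl.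
  apply: cvgM; first exact: cvg_cst.
  exact: (is_derive_continuous (is_derive_powRBl (- al) sT)).
have := Rintegral_FTC an dP cf; rewrite /Rintegral => E.
rewrite -[RHS]fineK; last first.
  apply: integrable_fin_num => //; exact: continuous_itv_integrable.
rewrite E; congr EFin.
have -> : T - (T - n.+1%:R^-1) = n.+1%:R^-1 by ring.
ring.
Unshelve. all: by end_near. Qed.

End PowerKernels.

(** * Summation by parts *)

Section Summation.
Set Implicit Arguments. Unset Strict Implicit.
Variable R : realType.
Implicit Types (B w a z r : nat -> R).

(** The coefficient of w_l on the left is B_1 plus the increments of B up to l, which telescopes to
    B_l. *)
Lemma abel_sum B w n : (0 < n)%N ->
  \sum_(1 <= j < n) (B j.+1 - B j) * (\sum_(j.+1 <= l < n) w l)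
    + B 1%N * (\sum_(1 <= l < n) w l) = \sum_(1 <= k < n) B k * w k.
Proof.
case: n => // n _; elim: n => [|n IH].
  by rewrite !big_geq // mulr0 addr0.
rewrite [in RHS]big_nat_recr //= -IH [X in B 1%N * X]big_nat_recr //=.
rewrite [X in X + _ = _]big_nat_recr //= [X in _ * X]big_geq // mulr0 addr0.
have -> : \sum_(1 <= j < n.+1) (B j.+1 - B j) * (\sum_(j.+1 <= l < n.+2) w l) =
  \sum_(1 <= j < n.+1) (B j.+1 - B j) * (\sum_(j.+1 <= l < n.+1) w l) +
  \sum_(1 <= j < n.+1) (B j.+1 - B j) * w n.+1.
  rewrite -big_split /=; apply: eq_big_nat => j /andP[_ jn].
  by rewrite big_nat_recr //= mulrDr.
by rewrite -mulr_suml telescope_sumr //; ring.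
Qed.

(** Appending w_n to a tail sum S_j changes its square by 2 w_n S_j + w_n^2. The cross terms are
    resummed by [abel_sum], and the coefficients of w_n^2 telescope to B_n. *)
Lemma quadratic_abel_sum B w n : (0 < n)%N ->
  \sum_(1 <= j < n) (B j.+1 - B j) * (\sum_(j.+1 <= l < n.+1) w l) ^+ 2
    + B 1%N * (\sum_(1 <= l < n.+1) w l) ^+ 2
  - (\sum_(1 <= j < n) (B j.+1 - B j) * (\sum_(j.+1 <= l < n) w l) ^+ 2
    + B 1%N * (\sum_(1 <= l < n) w l) ^+ 2)
  = 2 * w n * (\sum_(1 <= k < n) B k * w k) + B n * w n ^+ 2.
Proof.
move=> n0; rewrite -(abel_sum B w n0) [X in B 1%N * X ^+ 2]big_nat_recr //=.
have -> : \sum_(1 <= j < n) (B j.+1 - B j) * (\sum_(j.+1 <= l < n.+1) w l) ^+ 2 =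
  \sum_(1 <= j < n) (B j.+1 - B j) * (\sum_(j.+1 <= l < n) w l) ^+ 2 +
  (\sum_(1 <= j < n) (B j.+1 - B j) * (\sum_(j.+1 <= l < n) w l)) * (2 * w n) +
  (\sum_(1 <= j < n) (B j.+1 - B j)) * w n ^+ 2.
  rewrite !mulr_suml -!big_split /=; apply: eq_big_nat => j /andP[_ jn].
  by rewrite big_nat_recr //=; ring.
by rewrite telescope_sumr //; ring.
Qed.

(** Shifting the index in the terms containing w_{k+1} collects the coefficient of each w_k. With
    z_0 = 0 the same formula covers k = 1, where r_1 is arbitrary. *)
Lemma shift_sum a z r w n : z 0%N = 0 -> (0 < n)%N ->
  (forall k, (1 < k <= n)%N -> 0 < r k) ->
  \sum_(1 <= k < n) (a k * w k + (w k.+1 - r k.+1 * w k)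
      / (r k.+1 * (1 + r k.+1)) * z k) =
  \sum_(1 <= k < n) (a k + z k.-1 / (r k * (1 + r k)) - z k / (1 + r k.+1)) * w k
    + z n.-1 / (r n * (1 + r n)) * w n.
Proof.
move=> z0; case: n => // n _; elim: n => [|n IH] r0.
  by rewrite !big_geq //= z0 !mul0r addr0.
rewrite big_nat_recr //= IH; last by move=> k /andP[k1 kn]; rewrite r0 // k1 ltnW.
rewrite [in RHS]big_nat_recr //=.
have rn : 0 < r n.+2 by apply: r0; rewrite leqnn.
have r1 : r n.+2 != 0 by rewrite gt_eqF.
have r2 : 1 + r n.+2 != 0 by rewrite gt_eqF // addr_gt0 //.
(* For n = 0 this quotient involves the arbitrary r_1, so it is kept opaque for [field]. *)
set u := z n / (r n.+1 * (1 + r n.+1)).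
by field; rewrite r1 r2.
Qed.

End Summation.

(** * Scalar inequalities around the root equation, and the last cell *)

Section LocalInequalities.
Set Implicit Arguments. Unset Strict Implicit.
Variable R : realType.
Implicit Types (al g l h r rs T x : R).

(* The radicand in [rstar_eq]. *)
Definition kappa (al rs : R) : R :=
  2 * (1 - al / 2) * rs / (1 + al + (1 - al / 2) * rs) + rs / (1 + rs).

Lemma kappa_ge0 al rs : 0 < al < 1 -> 0 < rs -> 0 <= kappa al rs.
Proof.
move=> /andP[a0 a1] r0; have q0 : 0 < 1 - al / 2 by lra.
have q1 : 0 < (1 - al / 2) * rs by rewrite mulr_gt0.
by rewrite addr_ge0 // divr_ge0 //; try nra; rewrite -?mulrA ?mulr_ge0; lra.
Qed.

Lemma ler_ratio x r : 0 <= x -> x <= r -> x / (1 + x) <= r / (1 + r).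
Proof.
move=> x0 xr.
have e (z : R) : 0 <= z -> z / (1 + z) = 1 - (1 + z)^-1.
  by move=> z0; field; rewrite gt_eqF //; lra.
rewrite !e //; last exact: le_trans xr.
by rewrite lerD2l lerN2 lef_pV2 ?posrE; lra.
Qed.

(** The first fraction of [kappa] is at most 2, the second at most 1 - 1 / (1 + r). The bound
    matches the factor 1/2 - k/6 of [meanB_slant_ge] with k = 1 / (1 + r). *)
Lemma kappa_le_interior al rs r : 0 < al < 1 -> 0 < rs -> rs <= r ->
  kappa al rs <= 3 - (1 + r)^-1.
Proof.
move=> /andP[a0 a1] r0 rr; have q0 : 0 < 1 - al / 2 by lra.
have q1 : 0 < (1 - al / 2) * rs by rewrite mulr_gt0.
have -> : 3 - (1 + r)^-1 = 2 + r / (1 + r) by field; rewrite gt_eqF; lra.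
apply: lerD; last by apply: ler_ratio => //; exact: ltW.
rewrite ler_pdivrMr; last by lra.
by rewrite -mulrA ler_wpM2l //; lra.
Qed.

(** Since 1 - al/2 <= 1 + al, the first fraction is at most 2 rs / (1 + rs). This sharper bound,
    small with r, is the one that the last cell requires. *)
Lemma kappa_le al rs r : 0 < al < 1 -> 0 < rs -> rs <= r ->
  kappa al rs <= 3 * (r / (1 + r)).
Proof.
move=> /andP[a0 a1] r0 rr; have q0 : 0 < 1 - al / 2 by lra.
have q1 : 0 < (1 - al / 2) * rs by rewrite mulr_gt0.
have /(ler_ratio (ltW r0)) k : rs <= r by [].
apply: (@le_trans _ _ (2 * (rs / (1 + rs)) + rs / (1 + rs))); last by lra.
rewrite lerD2r ler_pdivrMr; last by lra.
have -> : 2 * (rs / (1 + rs)) * (1 + al + (1 - al / 2) * rs) =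
    2 * rs * ((1 + al + (1 - al / 2) * rs) / (1 + rs)).
  by field; rewrite gt_eqF; lra.
have -> : 2 * (1 - al / 2) * rs = 2 * rs * (1 - al / 2) by ring.
rewrite ler_wpM2l //; first by lra.
rewrite ler_pdivlMr; last by lra.
by rewrite mulrDr mulr1; lra.
Qed.

(* AM-GM: the terms in the free ratio r' satisfy 1/r' + kap r' >= 2 sqrt kap. *)
Lemma stencil_ge0 (kap rs tau p r' X U Zk Zm : R) :
  0 < rs -> 0 <= kap -> 2 * Num.sqrt kap + 3 - 1 / (rs ^+ 2 * (1 + rs)) = 0 ->
  0 < tau -> 0 < r' -> 0 <= p ->
  kap * (r' * tau) * p / 6 <= X -> tau * p / 2 <= U -> tau * p / 6 <= Zk ->
  Zm <= tau * p / 6 / (rs ^+ 2 * (1 + rs)) ->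
  0 <= X + U + Zk / r' - Zm.
Proof.
move=> rs0 kap0 E tau0 r0 p0 hX hU hZk hZm.
set W := (rs ^+ 2 * (1 + rs))^-1 in hZm.
have EW : W = 2 * Num.sqrt kap + 3 by move: E; rewrite div1r -/W; lra.
have tp : 0 <= tau * p / 6 by rewrite divr_ge0 // mulr_ge0 // ltW.
have amgm : 2 * Num.sqrt kap <= r'^-1 + kap * r'.
  rewrite -{2}(sqr_sqrtr kap0) -subr_ge0.
  have -> : r'^-1 + Num.sqrt kap ^+ 2 * r' - 2 * Num.sqrt kap =
    r'^-1 * (1 - Num.sqrt kap * r') ^+ 2 by field; rewrite gt_eqF.
  by rewrite mulr_ge0 ?sqr_ge0 // invr_ge0 ltW.
have hZk' : tau * p / 6 / r' <= Zk / r' by rewrite ler_wpM2r // invr_ge0 ltW.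
(* In units of tau p / 6 the four hypotheses contribute kap r', 3, 1/r' and W, in this order; the
   root equation reads W = 2 sqrt kap + 3. *)
have h : 0 <= (tau * p / 6) * (kap * r' + 3 + r'^-1 - W).
  by rewrite mulr_ge0 // EW; lra.
have e : (tau * p / 6) * (kap * r' + 3 + r'^-1 - W) =
  kap * (r' * tau) * p / 6 + tau * p / 2 + tau * p / 6 / r' - tau * p / 6 * W.
  by field; rewrite gt_eqF.
by move: h; rewrite e; lra.
Qed.

Definition power_kernel g T al := fun s : R => g * (T - s) `^ (- al).

Lemma continuous_power_kernel g T al x : x < T ->
  {for x, continuous (power_kernel g T al)}.
Proof.
move=> xT; apply: cvgM; first exact: cvg_cst.
exact: (is_derive_continuous (is_derive_powRBl (- al) xT)).
Qed.

(* The choice theta = al / 2 makes this combination exact: the integrand has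
   the primitive - (T - s)^(1 - al) (h - s) up to a constant factor. *)
Lemma meanB_slant_power_kernel g al l h r : 0 < al < 1 -> l < h -> 0 < r ->
  let T := h + (1 - al / 2) * (r * (h - l)) in
  mean (power_kernel g T al) l h - (1 + r)^-1 * slant (power_kernel g T al) l h =
  power_kernel g T al l * (T - l) / ((1 - al / 2) * (1 + r) * (h - l)).
Proof.
move=> /andP[a0 a1] lh r0 T.
have q0 : 0 < 1 - al / 2 by lra.
have q2 : 0 < 2 - al by lra.
have h0 : 0 < h - l by rewrite subr_gt0.
have hT : h < T by rewrite /T ltrDl !mulr_gt0.
have cG x : l <= x <= h -> {for x, continuous (power_kernel g T al)}.
  by move=> /andP[_ xh]; apply: continuous_power_kernel; exact: le_lt_trans hT.
rewrite meanB_slant //.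
set c := g / ((1 - al / 2) * (1 + r) * (h - l) ^+ 2).
have dP (x : R) : l <= x <= h ->
    is_derive x 1 (fun s => - c * ((T - s) `^ (1 - al) * (h - s)))
      (((h - l)^-1 + - ((1 + r)^-1 * (2 / (h - l) ^+ 2)) * (x - (l + h) / 2)) *
       power_kernel g T al x).
  move=> /andP[lx xh]; have xT : x < T by exact: le_lt_trans hT.
  have d := is_derive_powRBl (1 - al) xT.
  apply: is_derive_eq; rewrite /GRing.scale /= /power_kernel.
  have -> : 1 - al - 1 = - al by ring.
  have -> : (T - x) `^ (1 - al) = (T - x) * (T - x) `^ (- al).
    by rewrite -(@mulr_powRB1 _ _ (1 - al)) ?subr_ge0 ?subr_gt0 ?(ltW xT) //;
       congr (_ * _ `^ _); ring.
  move: ((T - x) `^ (- al)) => y.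
  (* Without the power, both sides are multiples of 2 (h - x) + r (h - l): on the left because (1 -
     al) + 1 = 2 (1 - al/2). *)
  rewrite /c /T; field.
  by rewrite !gt_eqF //; lra.
rewrite /moment (Rintegral_FTC lh dP); last first.
  by move=> x /cG; exact: continuous_affine_mul.
have -> : (T - l) `^ (1 - al) = (T - l) * (T - l) `^ (- al).
  have lT : l < T by exact: lt_trans hT.
  by rewrite -(@mulr_powRB1 _ _ (1 - al)) ?subr_ge0 ?subr_gt0 ?(ltW lT) //;
     congr (_ * _ `^ _); ring.
rewrite /c /power_kernel; move: ((T - l) `^ (- al)) => y.
field.
by rewrite !gt_eqF //; lra.
Qed.

(** Here l, h, T0, T are t_{n-1}, t_n, t_{n-theta}, t_{n+1-theta}, and r is r_{n+1}. With rho = al /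
    (2 - al) and F, H the two kernels at l, the closed form turns the right side into F - H rho / (1
    + r) and the left into F rho kappa / 3. As H <= F and rho <= 1, [kappa_le] concludes. *)
Lemma last_step_ge g al l h r rs (T := h + (1 - al / 2) * (r * (h - l)))
  (T0 := l + (1 - al / 2) * (h - l)) :
  0 < al < 1 -> 0 <= g -> l < h -> 0 < rs -> rs <= r ->
  kappa al rs * (h - l) * (al * (power_kernel g T0 al l / (T0 - l))) / 6 <=
  power_kernel g T0 al l + power_kernel g T al l -
   (mean (power_kernel g T al) l h - (1 + r)^-1 * slant (power_kernel g T al) l h).
Proof.
move=> al01 g0 lh rs0 rr; have r0 := lt_le_trans rs0 rr.
rewrite meanB_slant_power_kernel // -/T; case/andP: (al01) => a0 a1.
have q0 : 0 < 1 - al / 2 by lra.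
have h0 : 0 < h - l by rewrite subr_gt0.
have T0l : T0 - l = (1 - al / 2) * (h - l) by rewrite /T0; ring.
have T0T : T0 <= T.
  have : 0 <= (1 - al / 2) * (r * (h - l)) by rewrite !mulr_ge0 // ltW.
  have : (1 - al / 2) * (h - l) <= h - l by rewrite ler_piMl ?(ltW h0) //; lra.
  rewrite /T /T0; lra.
have lT0 : l < T0 by rewrite -subr_gt0 T0l mulr_gt0.
set F := power_kernel g T0 al l; set H := power_kernel g T al l.
have HF : H <= F.
  rewrite ler_wpM2l // powRN_ge ?subr_gt0 ?lerD2r //; exact: ltW.
have H0 : 0 <= H by rewrite mulr_ge0 ?powR_ge0.
have -> : F + H - H * (T - l) / ((1 - al / 2) * (1 + r) * (h - l)) =
  F - H * ((al / (2 - al)) / (1 + r)).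
  by rewrite /T; field; rewrite !gt_eqF //; lra.
have rho1 : al / (2 - al) <= 1 by rewrite ler_pdivrMr; lra.
have rho0 : 0 <= al / (2 - al) by rewrite divr_ge0 //; lra.
have -> : kappa al rs * (h - l) * (al * (F / (T0 - l))) / 6 =
    F * (al / (2 - al)) * (kappa al rs / 3).
  by rewrite T0l; field; rewrite !gt_eqF //; lra.
have F0 : 0 <= F by exact: le_trans HF.
have kk := kappa_le al01 rs0 rr.
have rho01 : 0 <= al / (2 - al) / (1 + r) by rewrite divr_ge0 //; lra.
apply: (@le_trans _ _ (F * (1 - al / (2 - al) / (1 + r)))); last first.
  have := ler_wpM2r rho01 HF; lra.
rewrite -mulrA ler_wpM2l //.
apply: (@le_trans _ _ (al / (2 - al) * (r / (1 + r)))).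
  by rewrite ler_wpM2l //; lra.
have -> : r / (1 + r) = 1 - (1 + r)^-1 by field; rewrite gt_eqF //; lra.
by lra.
Qed.

End LocalInequalities.

(** * Monotonicity and positivity of the discrete kernels on the mesh *)

Section Mesh.
Set Implicit Arguments. Unset Strict Implicit.
Variables (R : realType) (al : R) (N : nat) (t : nat -> R) (rs : R).
Hypothesis al01 : 0 < al < 1.
Hypothesis t_incr : forall k, (1 <= k <= N)%N -> t k.-1 < t k.
Hypothesis rs_gt0 : 0 < rs.
Hypothesis rs_root : rstar_eq al rs = 0.
Hypothesis ratio_ge : forall k, (2 <= k <= N)%N -> rs <= step_ratio t k.
Notation leb := (@lebesgue_measure R).
Notation r := (step_ratio t).

Let T n := Defs.tnth al t n.
Let g := (Gamma (1 - al))^-1.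
Let G n := power_kernel g (T n) al.
Let M (f : R -> R) k := mean f (t k.-1) (t k).
(* The value 0 at k = 0 makes the formula for the kernels uniform in k; the
   ratio r_1, which divides it, is a junk value. *)
Let Z (f : R -> R) k := if k is 0%N then 0 else slant f (t k.-1) (t k).

Let al0 : 0 < al. Proof. by case/andP: al01. Qed.
Let al1 : al < 1. Proof. by case/andP: al01. Qed.
Let q0 : 0 < 1 - al / 2. Proof. by move: al0 al1; lra. Qed.

Let g_ge0 : 0 <= g.
Proof.
rewrite invr_ge0; apply: Rintegral_ge0 => x _.
by rewrite mulr_ge0 ?powR_ge0 ?expR_ge0.
Qed.

Let omega_power_kernel n : (fun s => omega (1 - al) (Defs.tnth al t n - s)) = G n.
Proof.
apply/funext => s; rewrite /omega /G /power_kernel mulrC.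
by congr (_ * _ `^ _); ring.
Qed.

Let tau_gt0 k : (1 <= k <= N)%N -> 0 < tau t k.
Proof. by move=> /t_incr; rewrite subr_gt0. Qed.

Let t_le j k : (j <= k <= N)%N -> t j <= t k.
Proof.
case/andP; elim: k => [|k IH] jk kN; first by move: jk; rewrite leqn0 => /eqP ->.
move: jk; rewrite leq_eqVlt ltnS => /predU1P[->//|jk].
by rewrite (le_trans (IH jk (ltnW kN))) // ltW // (t_incr (k := k.+1)).
Qed.

Let TE n : T n = t n.-1 + (1 - al / 2) * tau t n.
Proof. by rewrite /T /Defs.tnth /theta /tau; field. Qed.

Let t_lt_T k n : (k < n <= N)%N -> t k < T n.
Proof.
case: n => // n /andP[kn nN]; rewrite TE.
have : t k <= t n by apply: t_le; lia.
have : 0 < (1 - al / 2) * tau t n.+1 by rewrite mulr_gt0 ?tau_gt0 //; lia.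
by rewrite /=; lra.
Qed.

Let T_le n : (1 <= n)%N -> (n.+1 <= N)%N -> T n <= T n.+1.
Proof.
case: n => // n _ nN; rewrite !TE /=.
have h1 : 0 < tau t n.+1 by apply: tau_gt0; lia.
have h2 : 0 < (1 - al / 2) * tau t n.+2 by rewrite mulr_gt0 ?tau_gt0 //; lia.
have h3 : (1 - al / 2) * tau t n.+1 <= tau t n.+1.
  by rewrite ler_piMl ?(ltW h1) //; move: al0; lra.
by rewrite {2}/tau /= in h3; lra.
Qed.

Let r_gt0 k : (2 <= k <= N)%N -> 0 < r k.
Proof. by move=> /ratio_ge; exact: lt_le_trans. Qed.

Let tauS k : (1 <= k)%N -> (k.+1 <= N)%N -> tau t k.+1 = r k.+1 * tau t k.
Proof.
move=> k1 kN; rewrite /step_ratio /= divfK // gt_eqF // tau_gt0 //; lia.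
Qed.

Let G_cont n k x : (k < n <= N)%N -> x <= t k -> {for x, continuous (G n)}.
Proof.
move=> /t_lt_T kn xk; apply: continuous_power_kernel; exact: le_lt_trans kn.
Qed.

Let akernE n k : (1 <= k)%N -> (k < n <= N)%N -> akern al t n (n - k) = M (G n) k.
Proof.
move=> k1 kn; rewrite /akern subKn; last by lia.
rewrite omega_power_kernel min_l; last exact/ltW/t_lt_T.
rewrite /M /mean /moment -RintegralZl //.
  by apply: eq_Rintegral => x _; rewrite mul0r addr0.
by apply: continuous_itv_integrable => x /andP[_]; exact: G_cont.
Qed.

Let zetaE n k : (1 <= k)%N -> (k < n <= N)%N -> zeta al t n (n - k) = Z (G n) k.
Proof.
case: k => // k _ kn; rewrite /zeta subKn; last by lia.
rewrite /Z /slant /moment -RintegralZl //.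
  apply: eq_Rintegral => x _.
  by rewrite add0r -mulrA -omega_power_kernel.
apply: continuous_itv_integrable => x /andP[_ xk].
apply: cvgM; last by have := G_cont kn xk; rewrite -omega_power_kernel.
by apply: cvgB; [exact: cvg_id|exact: cvg_cst].
Qed.

(** The integral stops at t_{n-theta}, where the kernel is singular. Since t_{n-theta} - t_{n-1} =
    (1 - al/2) tau_n, its exact value carries the factor (1 - al/2) / (1 - al), which the prefactor
    cancels. *)
Let akern0 n : (1 <= n <= N)%N ->
  2 * (1 - al) / (2 - al) * akern al t n 0 = G n (t n.-1).
Proof.
move=> nN; rewrite /akern subn0 min_r; last first.
  rewrite -/(T n) TE; have := tau_gt0 nN; have -> : t n = t n.-1 + tau t n.
    by rewrite /tau addrC subrK.
  by move=> h; rewrite lerD2l ler_piMl ?(ltW h) //; move: al0; lra.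
have h := tau_gt0 nN.
have lT : t n.-1 < T n by apply: t_lt_T; lia.
rewrite omega_power_kernel /G /power_kernel Rintegral_powRN_singular //.
have -> : (T n - t n.-1) `^ (1 - al) = (T n - t n.-1) * (T n - t n.-1) `^ (- al).
  by rewrite -(@mulr_powRB1 _ _ (1 - al)) ?subr_ge0 ?subr_gt0 ?(ltW lT) //;
     congr (_ * _ `^ _); ring.
have -> : T n - t n.-1 = (1 - al / 2) * tau t n by rewrite TE; ring.
move: (_ `^ (- al)) => y; field.
by rewrite !gt_eqF //; move: al0 al1; lra.
Qed.

(** Indexing by the cell k instead of the distance n - k turns the coefficients of [Gfun] into
    forward differences in k. *)
Let B n k := Akern al t n (n - k).

Let B_lt n k : (1 <= k)%N -> (k < n <= N)%N ->
  B n k = M (G n) k + Z (G n) k.-1 / (r k * (1 + r k))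
          - Z (G n) k / (1 + r k.+1).
Proof.
move=> k1 kn; rewrite /B /Akern /ahat.
have -> : (n - k == 0)%N = false by lia.
have -> : (n == 1)%N = false by lia.
have [nk|nk] := eqVneq (n - k)%N n.-1.
  have k_1 : k = 1%N by lia.
  subst k; rewrite -subn1 akernE // zetaE //=.
  by rewrite mul0r addr0.
rewrite subKn; last by lia.
have -> : (n - k).+1 = (n - k.-1)%N by lia.
by rewrite akernE // !zetaE //; lia.
Qed.

Let B_diag n : (1 <= n <= N)%N ->
  B n n = 2 * (G n (t n.-1) + Z (G n) n.-1 / (r n * (1 + r n))).
Proof.
move=> nN; rewrite /B /Akern /ahat subnn /=.
have [n1|n1] := eqVneq n 1%N.
  by subst n; rewrite akern0 //= mul0r addr0.
rewrite akern0 //; have -> : 1%N = (n - n.-1)%N by lia.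
by rewrite zetaE //; lia.
Qed.

Let dG n := power_kernel_diff (al * g) (T n) (T n) 0 (al + 1).
(** Means and slants are linear in the kernel, so away from the diagonal the coefficients of [Rfun]
    are those of [Gfun] computed with this kernel. *)
Let K n := fun s => G n s - G n.+1 s.
Let dK n := power_kernel_diff (al * g) (T n) (T n.+1) 1 (al + 1).

Let G_convex n : convex_kernel (G n) (dG n) (T n).
Proof.
have -> : G n = power_kernel_diff g (T n) (T n) 0 al.
  by apply/funext => s; rewrite /G /power_kernel /power_kernel_diff mul0r subr0.
by apply: convex_power_kernel_diff; rewrite ?lexx ?ler01 // ltW.
Qed.

Let K_convex n : (1 <= n)%N -> (n.+1 <= N)%N -> convex_kernel (K n) (dK n) (T n).
Proof.
move=> n1 nN; have -> : K n = power_kernel_diff g (T n) (T n.+1) 1 al.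
  by apply/funext => s; rewrite /K /G /power_kernel /power_kernel_diff mul1r mulrBr.
by apply: convex_power_kernel_diff; rewrite ?lexx ?ler01 ?T_le // ltW.
Qed.

Let dGE n s : s < T n -> dG n s = al * (G n s / (T n - s)).
Proof.
rewrite -subr_gt0 => sT; rewrite /dG /power_kernel_diff mul0r subr0 /G /power_kernel.
have -> : (T n - s) `^ (- al) = (T n - s) * (T n - s) `^ (- (al + 1)).
  rewrite opprD (@powRD _ _ (- al)); last by rewrite (gt_eqF sT) implybT.
  by rewrite mulrCA powR_inv1 ?(ltW sT) // divff ?gt_eqF // mulr1.
by move: (_ `^ _) => y; field; rewrite gt_eqF.
Qed.

Let dK_le_dG n s : dK n s <= dG n s.
Proof.
rewrite /dK /dG /power_kernel_diff ler_wpM2l ?mulr_ge0 ?(ltW al0) //.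
by rewrite mul0r subr0 mul1r gerBl powR_ge0.
Qed.

(** By convexity the slope p of f at t_{k-1} bounds the slopes from below on cell k and from above
    on cell k - 1, which gives the hypotheses of [stencil_ge0]. The contribution X from the right of
    t_k is left free, because interior cells, the diagonal entry and the kernel difference supply it
    differently. *)
Let second_diff_ge0 f df S k X :
  convex_kernel f df S -> (1 <= k)%N -> (k.+1 <= N)%N ->
  t k < S -> kappa al rs * tau t k.+1 * df (t k.-1) / 6 <= X ->
  0 <= X + (f (t k) - M f k) + Z f k / r k.+1 - Z f k.-1 / (r k * (1 + r k)).
Proof.
move=> fP k1 kN tS hX; set p := df (t k.-1).
have tk : t k.-1 < t k by apply: t_incr; lia.
have fc x : x <= t k -> {for x, continuous f}.
  by move=> xk; apply: (convex_kernel_continuous fP); exact: le_lt_trans tS.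
have cc x : t k.-1 <= x <= t k -> {for x, continuous f}.
  by move=> /andP[_ /fc].
have p0 : 0 <= p by case: fP => _ _ + _; apply; exact: lt_trans tS.
have fs x y : t k.-1 <= x -> x <= y -> y <= t k -> p * (y - x) <= f y - f x.
  move=> cx xy yk; apply: (convex_kernel_ge_slope fP) => //.
  exact: le_lt_trans tS.
have tau0 : 0 < tau t k by apply: tau_gt0; clear -k1 kN; lia.
rewrite tauS // in hX.
apply: (stencil_ge0 rs_gt0 (kappa_ge0 al01 rs_gt0) rs_root tau0 _ p0 hX).
- by apply: r_gt0; clear -k1 kN; lia.
- by have := mean_le tk cc fs; rewrite /M /tau; lra.
- by case: (k) k1 tk cc fs => // j _; exact: slant_ge.
have w0 : 0 < rs ^+ 2 * (1 + rs) by rewrite mulr_gt0 ?exprn_gt0 ?addr_gt0.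
have tp : 0 <= tau t k * p / 6 by rewrite divr_ge0 // mulr_ge0 // ltW.
(* The first cell has no left neighbour; there [Z f 0] is 0 by definition. *)
have [k2|k2] := ltnP 1 k; last first.
  have -> : Z f k.-1 = 0 by case: (k) k2 => [|[]].
  by rewrite mul0r divr_ge0 // ltW.
have rk : rs <= r k by apply: ratio_ge; rewrite k2 ltnW.
have rk0 : 0 < r k by exact: lt_le_trans rk.
have tj : t k.-2 < t k.-1 by apply: t_incr; clear -k2 kN; lia.
have -> : Z f k.-1 = slant f (t k.-2) (t k.-1) by case: (k) k2 => [|[]].
have sl : slant f (t k.-2) (t k.-1) <= tau t k.-1 * p / 6.
  apply: slant_le => // [x /andP[_ xk]|x y _ xy yk].
    by apply: fc; rewrite (le_trans xk) // ltW.
  by apply: (convex_kernel_le_slope fP) => //; exact: lt_trans tS.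
have tauk : tau t k = r k * tau t k.-1.
  by rewrite /step_ratio divfK // gt_eqF // tau_gt0 //; clear -k2 kN; lia.
(* Substituting tau_{k-1} = tau_k / r_k produces 1 / (r_k^2 (1 + r_k)), which decreases in r_k and
   so is largest at rs. *)
apply: (@le_trans _ _ (tau t k.-1 * p / 6 / (r k * (1 + r k)))).
  by rewrite ler_wpM2r // invr_ge0 mulr_ge0 // ltW // addr_gt0.
have -> : tau t k.-1 * p / 6 / (r k * (1 + r k)) =
    tau t k * p / 6 / (r k ^+ 2 * (1 + r k)).
  by rewrite tauk; field; rewrite !gt_eqF // addr_gt0.
rewrite ler_wpM2l // lef_pV2 ?posrE //; last first.
  by rewrite mulr_gt0 ?exprn_gt0 ?addr_gt0.
apply: ler_pM; rewrite ?sqr_ge0 ?lerD2l //; first by rewrite addr_ge0 // ltW.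
by rewrite lerXn2r // nnegrE ltW.
Qed.

(** The slant of cell k occurs with weights 1 / (r (1 + r)) and 1 / (1 + r), r = r_{k+1}, which add
    up to 1 / r. The combination of mean and slant on cell k + 1, minus f(t_k), plays the role of
    X. *)
Let interior_diff_ge0 f df S k :
  convex_kernel f df S -> (1 <= k)%N -> (k.+2 <= N)%N ->
  t k.+1 < S ->
  0 <= (M f k.+1 + Z f k / (r k.+1 * (1 + r k.+1)) - Z f k.+1 / (1 + r k.+2)) -
       (M f k + Z f k.-1 / (r k * (1 + r k)) - Z f k / (1 + r k.+1)).
Proof.
move=> fP k1 kN tS; set p := df (t k.-1).
have tk : t k < t k.+1 by apply: (t_incr (k := k.+1)); clear -k1 kN; lia.
have tk' : t k.-1 < t k by apply: t_incr; clear -k1 kN; lia.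
have cc x : t k <= x <= t k.+1 -> {for x, continuous f}.
  move=> /andP[_ xk]; apply: (convex_kernel_continuous fP).
  exact: le_lt_trans tS.
have p0 : 0 <= p.
  by case: fP => _ _ + _; apply; rewrite (lt_trans tk') // (lt_trans tk).
have fs x y : t k <= x -> x <= y -> y <= t k.+1 -> p * (y - x) <= f y - f x.
  move=> cx xy yk; apply: (convex_kernel_ge_slope fP) => //.
    by rewrite (le_trans _ cx) // ltW.
  exact: le_lt_trans tS.
have r2 : rs <= r k.+2 by apply: ratio_ge; clear -k1 kN; lia.
have r1 : 0 < r k.+1 by apply: r_gt0; clear -k1 kN; lia.
have r20 : 0 < r k.+2 by exact: lt_le_trans r2.
have k01 : 0 <= (1 + r k.+2)^-1 <= 1.
  by rewrite invr_ge0 invf_le1; lra.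
have tau0 : 0 < tau t k.+1 by apply: tau_gt0; clear -k1 kN; lia.
have h := meanB_slant_ge tk k01 cc fs.
have := @second_diff_ge0 f df S k
  (M f k.+1 - (1 + r k.+2)^-1 * Z f k.+1 - f (t k)) fP k1.
have -> : M f k.+1 - (1 + r k.+2)^-1 * Z f k.+1 - f (t k) + (f (t k) - M f k) +
    Z f k / r k.+1 - Z f k.-1 / (r k * (1 + r k)) =
  (M f k.+1 + Z f k / (r k.+1 * (1 + r k.+1)) - Z f k.+1 / (1 + r k.+2)) -
       (M f k + Z f k.-1 / (r k * (1 + r k)) - Z f k / (1 + r k.+1)).
  (* For k = 1 the generalized quotient contains r_1, about which nothing is known. *)
  by move: (Z f k.-1 / _) => u; field; rewrite !gt_eqF ?addr_gt0.
apply; [by clear -kN; lia|exact: lt_trans tS|].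
apply: (@le_trans _ _ (tau t k.+1 * p * (1 / 2 - (1 + r k.+2)^-1 / 6))).
  have := kappa_le_interior al01 rs_gt0 r2.
  have -> : kappa al rs * tau t k.+1 * p / 6 = tau t k.+1 * p * (kappa al rs / 6).
    by ring.
  by move=> kap; rewrite ler_wpM2l ?mulr_ge0 ?(ltW tau0) //; lra.
by move: h; rewrite /M /Z /tau /=; lra.
Qed.

Let MB n k : (1 <= k)%N -> (k < n)%N -> (n.+1 <= N)%N ->
  M (K n) k = M (G n) k - M (G n.+1) k.
Proof.
move=> k1 kn nN; apply: momentB => x /andP[_ xk]; apply: G_cont xk;
  clear -kn nN; lia.
Qed.

Let ZB n k : (k < n)%N -> (n.+1 <= N)%N ->
  Z (K n) k = Z (G n) k - Z (G n.+1) k.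
Proof.
case: k => [|k] kn nN; first by rewrite subr0.
apply: momentB => x /andP[_ xk]; apply: G_cont xk; clear -kn nN; lia.
Qed.

Let G_ge0 n k : (k < n <= N)%N -> 0 <= G n (t k).
Proof. by move=> /t_lt_T; case: (G_convex n) => _ _ _; apply. Qed.

Let Z_ge0 n k : (k < n <= N)%N -> 0 <= Z (G n) k.
Proof.
case: k => // k kn; have tT := t_lt_T kn.
have tk : t k < t k.+1 by apply: (t_incr (k := k.+1)); clear -kn; lia.
apply: (@le_trans _ _ ((t k.+1 - t k) * dG n (t k) / 6)); last first.
  apply: slant_ge => // [x /andP[_ xk]|x y kx xy yk].
    by apply: G_cont xk.
  by apply: (convex_kernel_ge_slope (G_convex n)) => //; exact: le_lt_trans tT.
rewrite divr_ge0 // mulr_ge0 ?subr_ge0 ?(ltW tk) //.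
by case: (G_convex n) => _ _ + _; apply; exact: lt_trans tT.
Qed.

(** By [dGE] the hypothesis involves the slope of G_n at t_k, which by convexity dominates the slope
    at t_{k-1}. *)
Let last_term n k X : (1 <= k)%N -> n = k.+1 -> (n <= N)%N ->
  kappa al rs * tau t n * (al * (G n (t k) / (T n - t k))) / 6 <= X ->
  kappa al rs * tau t n * dG n (t k.-1) / 6 <= X.
Proof.
move=> k1 nk nN; apply: le_trans.
have kT : t k < T n by apply: t_lt_T; clear -nk nN; lia.
rewrite -dGE // ler_wpM2r // ler_wpM2l //.
  rewrite mulr_ge0 ?kappa_ge0 // ltW // tau_gt0 //; clear -nk nN k1; lia.
case: (G_convex n) => _ + _ _; apply => //.
by apply: t_le; clear -nk nN k1; lia.
Qed.

Lemma Akern_mono n k : (1 <= k)%N -> (k < n <= N)%N -> B n k <= B n k.+1.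
Proof.
move=> k1 kn; have [k1n|k1n] := ltnP k.+1 n.
  rewrite -subr_ge0 !B_lt //; [|clear -k1n kn; lia..].
  apply: (interior_diff_ge0 (G_convex n)) => //; first by clear -k1n kn; lia.
  by apply: t_lt_T; clear -k1n kn; lia.
have nk : n = k.+1 by clear -k1n kn; lia.
have kN : (k.+1 <= N)%N by clear -k1n kn; lia.
have kT : t k < T n by apply: t_lt_T; clear -kn; lia.
have r1 : 0 < r k.+1 by apply: r_gt0; clear -k1 kN; lia.
have Gk : 0 <= G n (t k) by exact: G_ge0.
have -> : B n k.+1 = B n n by rewrite nk.
have nk' : n.-1 = k by rewrite nk.
rewrite -subr_ge0 (B_lt k1 kn) -nk B_diag ?nk'; last by clear -k1 kn; lia.
(* The diagonal entry carries a factor 2: one copy of G_n(t_k) is the f(t_k) of the stencil, the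
   other goes into X. *)
have := @second_diff_ge0 _ _ _ k (G n (t k) + Z (G n) k / (r n * (1 + r n)))
  (G_convex n) k1 kN kT.
rewrite -nk.
have -> : G n (t k) + Z (G n) k / (r n * (1 + r n)) + (G n (t k) - M (G n) k) +
   Z (G n) k / r n - Z (G n) k.-1 / (r k * (1 + r k)) =
  2 * (G n (t k) + Z (G n) k / (r n * (1 + r n))) -
   (M (G n) k + Z (G n) k.-1 / (r k * (1 + r k)) - Z (G n) k / (1 + r n)).
  rewrite nk; move: (Z (G k.+1) k.-1 / _) => u.
  by field; rewrite !gt_eqF ?addr_gt0.
apply; apply: (last_term k1 nk); first by rewrite nk.
apply: (@le_trans _ _ (G n (t k))); last first.
  rewrite lerDl divr_ge0 ?Z_ge0 // nk mulr_ge0 // ltW // addr_gt0 //.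
have -> : T n - t k = (1 - al / 2) * tau t n by rewrite TE nk /=; ring.
(* The mesh size cancels; kappa <= 3 and al / (2 - al) <= 1 leave at most G_n(t_k). *)
have -> : kappa al rs * tau t n * (al * (G n (t k) / ((1 - al / 2) * tau t n))) / 6 =
  G n (t k) * ((kappa al rs / 3) * (al / (2 - al))).
  have tau0 : 0 < tau t n by apply: tau_gt0; clear -k1 kn; lia.
  by field; rewrite !gt_eqF //; move: al1; lra.
rewrite ler_piMr //.
have kap := kappa_le_interior al01 rs_gt0 (lexx rs).
have kap0 := kappa_ge0 al01 rs_gt0.
have rho1 : al / (2 - al) <= 1 by rewrite ler_pdivrMr; move: al1; lra.
have rho0 : 0 <= al / (2 - al) by rewrite divr_ge0 //; move: al0 al1; lra.
have i0 : 0 <= (1 + rs)^-1 by rewrite invr_ge0; move: rs_gt0; lra.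
by rewrite mulr_ile1 //; lra.
Qed.

(** For n > 1 the entry integrates G_n against the nonnegative weight of [meanB_slant_weight_ge0];
    for n = 1 it is 2 G_1(t_0). *)
Lemma Akern_first_ge0 n : (1 <= n <= N)%N -> 0 <= B n 1.
Proof.
move=> nN; have [n1|n1] := ltnP 1 n; last first.
  have -> : n = 1%N by clear -nN n1; lia.
  have N1 : (0 < N)%N by clear -nN; lia.
  have G0 : 0 <= G 1 (t 0) by exact: G_ge0.
  by rewrite B_diag //= mul0r addr0 mulr_ge0.
have n1N : (1 < n <= N)%N by clear -nN n1; lia.
have r2 : 0 < r 2 by apply: r_gt0; clear -nN n1; lia.
rewrite B_lt // [Z _ 1.-1]/= mul0r addr0 [_ / (1 + r 2)]mulrC.
apply: meanB_slant_ge0.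
- by apply: (t_incr (k := 1)); clear -nN; lia.
- by rewrite invr_ge0 invf_le1; lra.
- by move=> x /andP[_ x1]; exact: G_cont x1.
- move=> x /andP[_ x1]; case: (G_convex n) => _ _ _; apply.
  by rewrite (le_lt_trans x1) // t_lt_T.
Qed.

Let last_step n : (1 <= n)%N -> (n.+1 <= N)%N ->
  kappa al rs * tau t n * (al * (G n (t n.-1) / (T n - t n.-1))) / 6 <=
  G n (t n.-1) + G n.+1 (t n.-1) -
    (M (G n.+1) n - (1 + r n.+1)^-1 * Z (G n.+1) n).
Proof.
move=> n1 nN.
have tn : t n.-1 < t n by apply: t_incr; clear -n1 nN; lia.
have rn : rs <= r n.+1 by apply: ratio_ge; clear -n1 nN; lia.
have := last_step_ge al01 g_ge0 tn rs_gt0 rn.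
have <- : T n.+1 = t n + (1 - al / 2) * (r n.+1 * (t n - t n.-1)).
  by rewrite TE tauS.
have <- : T n = t n.-1 + (1 - al / 2) * (t n - t n.-1) by rewrite TE.
(* [Z] reduces to [slant] only at a successor index. *)
by case: (n) n1.
Qed.

(** For k + 1 < n this is the interior inequality for [K n]. For k + 1 = n, cell n is diagonal at
    level n but interior at level n + 1, and [last_step] compares the two. *)
Lemma Akern_diff_mono n k : (1 <= k)%N -> (k < n)%N -> (n.+1 <= N)%N ->
  B n.+1 k.+1 - B n.+1 k <= B n k.+1 - B n k.
Proof.
move=> k1 kn nN; have n1 : (1 <= n)%N by clear -kn; lia.
have kN : (k.+1 <= N)%N by clear -kn nN; lia.
have kT : t k < T n by apply: t_lt_T; clear -kn nN; lia.
have KP := K_convex n1 nN.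
have [k1n|k1n] := ltnP k.+1 n.
  rewrite -subr_ge0 !B_lt //; [|clear -k1n kn nN; lia..].
  have := interior_diff_ge0 KP k1; rewrite !MB ?ZB //; [|clear -k1n kn; lia..].
  rewrite t_lt_T; last by clear -k1n nN; lia.
  have -> : (k.+2 <= N)%N by clear -k1n nN; lia.
  move=> /(_ isT isT); congr (0 <= _).
  rewrite -!pred_Sn.
  move: (r k * (1 + r k))^-1 (r k.+1 * (1 + r k.+1))^-1 => a b.
  move: (1 + r k.+1)^-1 (1 + r k.+2)^-1 => c d.
  move: (M _ k) (M _ k.+1) (M _ k) (M _ k.+1) => m1 m2 m3 m4.
  move: (Z _ k) (Z _ k.+1) (Z _ k.-1) (Z _ k) (Z _ k.+1) (Z _ k.-1).
  by move=> z1 z2 z3 z4 z5 z6; ring.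
have nk : n = k.+1 by clear -k1n kn; lia.
have r1 : 0 < r k.+1 by apply: r_gt0; clear -k1 kN; lia.
have -> : B n k.+1 = B n n by rewrite nk.
have kn1 : (k < n.+1 <= N)%N by clear -kn nN; lia.
have knN : (k < n <= N)%N by clear -kn nN; lia.
rewrite -subr_ge0 (B_lt k1 kn1) (B_lt k1 knN).
rewrite (B_lt (n := n.+1) (k := k.+1)) //; last first.
  by clear -kn nN; lia.
rewrite B_diag; last by clear -n1 nN; lia.
have nk' : n.-1 = k by rewrite nk.
have lst := last_step n1 nN; rewrite nk' in lst *.
have Z0 : 0 <= Z (G n) k by apply: Z_ge0; clear -kn nN; lia.
have W0 : 0 <= Z (G n) k / (r n * (1 + r n)).
  by rewrite divr_ge0 // nk mulr_ge0 // ltW // addr_gt0.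
set X := G n (t k) + G n.+1 (t k) -
    (M (G n.+1) n - (1 + r n.+1)^-1 * Z (G n.+1) n) in lst.
have hX : kappa al rs * tau t k.+1 * dK n (t k.-1) / 6 <=
    X + Z (G n) k / (r n * (1 + r n)).
  (* [last_step] bounds X by a slope of G_n, which is at least the slope of [K n]. *)
  apply: (@le_trans _ _ (kappa al rs * tau t n * dG n (t k.-1) / 6)); last first.
    apply: (last_term k1 nk); first by clear -nN; lia.
    by rewrite (le_trans lst) // lerDl.
  rewrite -nk ler_wpM2r // ler_wpM2l ?dK_le_dG // mulr_ge0 ?kappa_ge0 //.
  by rewrite ltW // tau_gt0 //; clear -n1 nN; lia.
have := second_diff_ge0 KP k1 kN kT hX.
rewrite MB // !ZB //; last by clear -kn; lia.
rewrite /X /K -nk; congr (0 <= _).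
rewrite nk -!pred_Sn.
move: (r k * (1 + r k))^-1 (1 + r k.+2)^-1 => a b.
move: (G k.+1 (t k)) (G k.+2 (t k)) (r k.+1) r1 => g1 g2 r' r'0.
move: (M (G k.+1) k) (M (G k.+2) k) (M (G k.+2) k.+1) => m1 m2 m3.
move: (Z (G k.+1) k) (Z (G k.+2) k) (Z (G k.+2) k.+1) => z1 z2 z3.
move: (Z (G k.+1) k.-1) (Z (G k.+2) k.-1) => z4 z5.
by field; rewrite !gt_eqF ?addr_gt0.
Qed.

(** For n > 1 the difference is an integral of [K n] against a nonnegative weight. For n = 1 it is
    the right side of [last_step] plus K_1(t_0), both nonnegative. *)
Lemma Akern_first_mono n : (1 <= n)%N -> (n.+1 <= N)%N -> B n.+1 1 <= B n 1.
Proof.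
move=> n1 nN; have t1 : t 0 < t 1.
  by apply: (t_incr (k := 1)); clear -nN; lia.
have r2 : 0 < r 2 by apply: r_gt0; clear -n1 nN; lia.
rewrite -subr_ge0; have [n2|n2] := ltnP 1 n.
  rewrite !B_lt //; [|clear -n2 nN; lia..].
  have e (m1 m2 z1 z2 c d : R) : m1 + 0 / d - z1 / c - (m2 + 0 / d - z2 / c) =
      m1 - m2 - c^-1 * (z1 - z2) by rewrite !mul0r; ring.
  have -> : M (G n) 1 + Z (G n) 1.-1 / (r 1 * (1 + r 1)) - Z (G n) 1 / (1 + r 2) -
    (M (G n.+1) 1 + Z (G n.+1) 1.-1 / (r 1 * (1 + r 1)) - Z (G n.+1) 1 / (1 + r 2))
    = M (K n) 1 - (1 + r 2)^-1 * Z (K n) 1.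
    rewrite (MB (isT : 1 <= 1)%N n2 nN) (ZB n2 nN).
    exact: e.
  have KP := K_convex n1 nN.
  have xT x : x <= t 1 -> x < T n.
    by move=> x1; rewrite (le_lt_trans x1) // t_lt_T // n2 ltnW.
  apply: meanB_slant_ge0 => //.
  - by rewrite invr_ge0 invf_le1; lra.
  - by move=> x /andP[_ /xT]; exact: (convex_kernel_continuous KP).
  - by move=> x /andP[_ /xT]; case: KP => _ _ _; apply.
have n_1 : n = 1%N by clear -n1 n2; lia.
have lst := last_step n1 nN; rewrite n_1 in lst nN *.
rewrite B_diag; last by clear -nN; lia.
rewrite B_lt // /= !mul0r !addr0.
have t0T : t 0 < T 1 by apply: t_lt_T; clear -nN; lia.
have G0 : 0 <= G 1 (t 0) by apply: G_ge0; clear -nN; lia.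
have lhs0 : 0 <= kappa al rs * tau t 1 * (al * (G 1 (t 0) / (T 1 - t 0))) / 6.
  have tau0 : 0 <= tau t 1 by rewrite ltW // tau_gt0 //; clear -nN; lia.
  have d0 : 0 <= (T 1 - t 0)^-1 by rewrite invr_ge0 subr_ge0 ltW.
  have k0 := kappa_ge0 al01 rs_gt0; have a0 := ltW al0.
  by rewrite divr_ge0 // mulr_ge0 // mulr_ge0 // mulr_ge0.
have KP := @K_convex 1 isT nN.
have : 0 <= K 1 (t 0) by case: KP => _ _ _; apply.
by move: lst lhs0; rewrite /K [_ / (1 + r 2)]mulrC /=; lra.
Qed.

(** [shift_sum] collects the coefficients. On the diagonal, half of [B n n] contains only 2 (1 - al)
    / (2 - al) of a^(n)_0; the remaining fraction al / (2 - al) is the last term. *)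
Lemma caputoL21_kernels v n : (1 <= n <= N)%N ->
  caputoL21 al t v n = \sum_(1 <= k < n) B n k * nabla v k +
    B n n / 2 * nabla v n + al / (2 - al) * akern al t n 0 * nabla v n.
Proof.
move=> nN; rewrite /caputoL21.
have n0 : (0 < n)%N by clear -nN; lia.
have kn k : (1 <= k < n)%N -> (k < n <= N)%N by clear -nN; lia.
have -> : \sum_(1 <= k < n) (akern al t n (n - k) * nabla v k +
     (nabla v k.+1 - r k.+1 * nabla v k) / (r k.+1 * (1 + r k.+1)) *
       zeta al t n (n - k)) =
   \sum_(1 <= k < n) (M (G n) k * nabla v k +
     (nabla v k.+1 - r k.+1 * nabla v k) / (r k.+1 * (1 + r k.+1)) * Z (G n) k).
  apply: eq_big_nat => k /[dup] kk /andP[k1 _].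
  by rewrite akernE ?zetaE // kn.
rewrite shift_sum //; last by move=> k kk; apply: r_gt0; clear -kk nN; lia.
have -> : \sum_(1 <= k < n) (M (G n) k + Z (G n) k.-1 / (r k * (1 + r k)) -
    Z (G n) k / (1 + r k.+1)) * nabla v k = \sum_(1 <= k < n) B n k * nabla v k.
  by apply: eq_big_nat => k /[dup] kk /andP[k1 _]; rewrite B_lt // kn.
rewrite B_diag // -akern0 //.
move: (\sum_(1 <= k < n) _) (Z (G n) n.-1 / _) (akern al t n 0) => S z a.
by field; rewrite !gt_eqF //; move: al1; lra.
Qed.

End Mesh.

(** * The functionals as quadratic forms in tail sums *)

Section Functionals.
Set Implicit Arguments. Unset Strict Implicit.
Variables (R : realType) (al : R) (t w : nat -> R).
Notation B n k := (Akern al t n (n - k)).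

Lemma GfunE n : (0 < n)%N -> Gfun al t w n =
  \sum_(1 <= j < n) (B n j.+1 - B n j) * (\sum_(j.+1 <= l < n.+1) w l) ^+ 2
    + B n 1 * (\sum_(1 <= l < n.+1) w l) ^+ 2.
Proof.
case: n => // n _; rewrite /Gfun /=; congr (_ + _).
by apply: eq_big_nat => j _; rewrite -subnDA addn1.
Qed.

Lemma RfunE n : (0 < n)%N -> Rfun al t w n.+1 =
  \sum_(1 <= j < n) (B n j.+1 - B n j - (B n.+1 j.+1 - B n.+1 j))
     * (\sum_(j.+1 <= l < n.+1) w l) ^+ 2
    + (B n 1 - B n.+1 1) * (\sum_(1 <= l < n.+1) w l) ^+ 2.
Proof.
case: n => // n _; rewrite /Rfun /=.
(* The top term, whose truncated index is meaningless, multiplies an empty sum and drops out. *)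
rewrite [X in X + _]big_nat_recr //= [X in _ * X ^+ 2]big_geq // expr0n mulr0 addr0.
congr (_ + _).
apply: eq_big_nat => j /andP[j1 jn].
have -> : (n.+2 - j - 2 = n.+1 - j.+1)%N by lia.
have -> : (n.+2 - j - 1 = n.+1 - j)%N by lia.
rewrite [(n.+2 - j.+1)%N]subSS; congr (_ * _); ring.
Qed.

(** R_n replaces the level n - 1 coefficients in G_{n-1} by those of level n. Both quadratic forms
    then share the coefficients [B n], and [quadratic_abel_sum] evaluates their difference. *)
Lemma Gfun_Rfun_sum n : (0 < n)%N ->
  Gfun al t w n - Gfun al t w n.-1 + Rfun al t w n =
  2 * w n * (\sum_(1 <= k < n) B n k * w k) + B n n * w n ^+ 2.
Proof.
case: n => // n _; rewrite -quadratic_abel_sum // GfunE //=.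
rewrite -addrA; congr (_ + _); case: n => [|n].
  by rewrite /Gfun /Rfun /= !big_geq // expr0n mulr0 !addr0 oppr0.
rewrite GfunE // RfunE //.
rewrite [X in _ = - (X + _)]big_nat_recr //= [X in _ = - (_ + _ * X ^+ 2 + _)]big_geq //.
rewrite expr0n mulr0 addr0.
rewrite [X in _ + (X + _)](_ : _ =
  \sum_(1 <= j < n.+1) (B n.+1 j.+1 - B n.+1 j) * (\sum_(j.+1 <= l < n.+2) w l) ^+ 2
  - \sum_(1 <= j < n.+1) (B n.+2 j.+1 - B n.+2 j) * (\sum_(j.+1 <= l < n.+2) w l) ^+ 2).
  by ring.
by rewrite -sumrB; apply: eq_bigr => j _; rewrite -mulrBl.
Qed.

End Functionals.

(** * The energy identity and the signs of its functionals *)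

Theorem theorem2p3 (R : realType) (al : R) (N : nat) (t : nat -> R) (rs : R)
  (v : nat -> R) (n : nat) :
  0 < al < 1 ->
  t 0%N = 0 ->
  (forall k, (1 <= k <= N)%N -> t k.-1 < t k) ->
  0 < rs -> rstar_eq al rs = 0 ->
  (forall k, (2 <= k <= N)%N -> rs <= step_ratio t k) ->
  (1 <= n <= N)%N ->
  2 * nabla v n * caputoL21 al t v n
    = Gfun al t (nabla v) n - Gfun al t (nabla v) n.-1
      + Rfun al t (nabla v) n + 2 * al * akern al t n 0 / (2 - al) * nabla v n ^+ 2
  /\ 0 <= Gfun al t (nabla v) n /\ 0 <= Rfun al t (nabla v) n.
Proof.
move=> al01 _ t_incr rs_gt0 rs_root ratio_ge nN.
have n0 : (0 < n)%N by case/andP: nN.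
split; [|split].
- rewrite (caputoL21_kernels al01 t_incr rs_gt0 ratio_ge _ nN) Gfun_Rfun_sum //.
  have : 2 - al != 0 by rewrite gt_eqF //; case/andP: al01; lra.
  move: (\sum_(1 <= k < n) _) (Akern _ _ _ _) (akern _ _ _ _) => S b a al2.
  by field.
- rewrite GfunE //; apply: addr_ge0; last first.
    rewrite mulr_ge0 ?sqr_ge0 //.
    exact: (Akern_first_ge0 al01 t_incr rs_gt0 ratio_ge).
  rewrite big_nat sumr_ge0 // => j /andP[j1 jn].
  rewrite mulr_ge0 ?sqr_ge0 // subr_ge0.
  apply: (Akern_mono al01 t_incr rs_gt0 rs_root ratio_ge) => //.
  by clear -jn nN; lia.
- case: n n0 nN => // -[|n] _ nN.
    by rewrite (_ : Rfun al t (nabla v) 1 = 0) // lexx.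
  rewrite RfunE //; apply: addr_ge0; last first.
    rewrite mulr_ge0 ?sqr_ge0 // subr_ge0.
    exact: (Akern_first_mono al01 t_incr rs_gt0 ratio_ge).
  rewrite big_nat sumr_ge0 // => j /andP[j1 jn].
  rewrite mulr_ge0 ?sqr_ge0 // subr_ge0.
  exact: (Akern_diff_mono al01 t_incr rs_gt0 rs_root ratio_ge).
Qed.
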